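(* Assume analytic determinacy. Let $X$ be a Banach lattice, let $(e_n)_{n=1}^\infty$ be a sequence of vectors in $X$ with $X=[e_n]$, and let $(e_n^\sharp)_{n=1}^\infty$ be a sequence of (possibly discontinuous) linear functionals $e_n^\sharp\colon X\to\mathbb R$ biorthogonal to $(e_n)$, i.e. $e_k^\sharp(e_n)=\delta_{k,n}$. Consider the following properties: (1) $(e_n)$ is an order basis for $X$ with corresponding functionals $(e_n^\sharp)$; (2) $(e_n)$ is a $\sigma$-order basis for $X$ with corresponding functionals $(e_n^\sharp)$; (3) $(e_n)$ is a uniform basis for $X$ with corresponding functionals $(e_n^\sharp)$; (4) $(e_n)$ is a Schauder basis for $X$ with corresponding functionals $(e_n^\sharp)$. Then (1)$\Leftrightarrow$(2)$\Rightarrow$(3)$\Rightarrow$(4). In particular, if any one of (1)--(4) holds, then all the functionals $e_n^\sharp$ are norm continuous.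
   Context: All Banach lattices are real. $[e_n]$ denotes the norm-closed linear span of $(e_n)$. ''$\forall^\infty n$'' means ''for all but finitely many $n$''. For a sequence $(x_n)$ and a vector $x$ in a Banach lattice $X$: - $x_n$ converges uniformly to $x$ if there is $z\in X_+$ with $\forall m\ \forall^\infty n\ |x_n-x|\le \frac zm$; - $x_n$ $\sigma$-order converges to $x$ if there is a sequence $z_m\downarrow 0$ in $X$ (decreasing with infimum $0$ in $X$) with $\forall m\ \forall^\infty n\ |x_n-x|\le z_m$; - $x_n$ order converges to $x$ if there is a net $z_\mu\downarrow 0$ in $X$ (decreasing with infimum $0$ in $X$) with $\forall \mu\ \forall^\infty n\ |x_n-x|\le z_\mu$. For $C$ one of norm, uniform, order, $\sigma$-order convergence, write $x=^C\sum_{n=1}^\infty x_n$ if the partial sums $\sum_{m=1}^n x_m$ $C$-converge to $x$. A sequence $(e_n)$ in $X$ is a $C$-basis for $X$ if for every $x\in X$ there is a unique $(a_n)\in\mathbb R^{\mathbb N}$ with $x=^C\sum_{n=1}^\infty a_ne_n$; a norm basis is a Schauder basis. The corresponding functionals of a $C$-basis are those given by $e_k^\sharp(x)=a_k$, where $(a_n)$ is this unique sequence. Analytic determinacy is the axiom that for every analytic ($\mathbf\Sigma^1_1$) set $A\subseteq\mathbb N^{\mathbb N}$ the infinite two-player game on $\mathbb N$ with payoff set $A$ is determined, i.e. one of the players has a winning strategy. *)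

(* Defs.v *)
From HB Require Import structures.
From mathcomp Require Import all_boot all_order all_algebra.
From mathcomp Require Import all_classical all_reals all_analysis.
Set Implicit Arguments.
Unset Strict Implicit.
Unset Printing Implicit Defensive.
Import Order.TTheory GRing.Theory Num.Theory.
Import numFieldNormedType.Exports.
Local Open Scope classical_set_scope.
Local Open Scope ring_scope.

(* The order and lattice operations are fields of the mixin, and not inherited
   from Order.Lattice, because HB rejects the join of Order.Lattice and
   CompleteNormedModule: RealDomain already inherits from both Order.Lattice
   and Zmodule without a common intermediate structure.
   In a real normed space, `|x| is the norm; the lattice absolute value is
   vjoin x (- x). *)
HB.mixin Record isBanachLattice (R : realType) X & CompleteNormedModule R X := {
  vle : rel X;
  vjoin : X -> X -> X;
  vmeet : X -> X -> X;
  vle_refl : reflexive vle;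
  vle_anti : antisymmetric vle;
  vle_trans : transitive vle;
  vjoin_le : forall x y z : X, vle (vjoin x y) z = vle x z && vle y z;
  vle_meet : forall x y z : X, vle z (vmeet x y) = vle z x && vle z y;
  vle_add2l : forall x y z : X, vle x y -> vle (z + x) (z + y);
  vscale_ge0 : forall (a : R) (x : X), 0 <= a -> vle 0 x -> vle 0 (a *: x);
  vnorm_le : forall x y : X,
    vle (vjoin x (- x)) (vjoin y (- y)) -> `|x| <= `|y|
}.

#[short(type="banachLatticeType")]
HB.structure Definition BanachLattice (R : realType) :=
  {X of CompleteNormedModule R X & isBanachLattice R X}.

Notation "x <=v y" := (vle x y) (at level 70, no associativity) : ring_scope.

Section Convergence.
Context {R : realType} {X : banachLatticeType R}.
Implicit Types (u : nat -> X) (x y z : X).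

Definition vabs x : X := vjoin x (- x).

Definition is_vinf (I : Type) (z : I -> X) (y : X) : Prop :=
  (forall i, y <=v z i) /\ (forall w, (forall i, w <=v z i) -> w <=v y).

Definition directed (I : Type) (leI : I -> I -> Prop) : Prop :=
  [/\ inhabited I,
      forall i, leI i i,
      forall i j k, leI i j -> leI j k -> leI i k &
      forall i j, exists k, leI i k /\ leI j k].

Definition norm_cvg u x : Prop := u @ \oo --> x.

Definition uniform_cvg u x : Prop :=
  exists2 z, 0 <=v z &
    forall m, (0 < m)%N ->
      \forall n \near \oo, vabs (u n - x) <=v (m%:R^-1 *: z).

Definition sigma_order_cvg u x : Prop :=
  exists z : nat -> X,
    [/\ forall m n, (m <= n)%N -> z n <=v z m,
        is_vinf z 0 &
        forall m, \forall n \near \oo, vabs (u n - x) <=v z m].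

Definition order_cvg u x : Prop :=
  exists (I : Type) (leI : I -> I -> Prop) (z : I -> X),
    [/\ directed leI,
        forall i j, leI i j -> z j <=v z i,
        is_vinf z 0 &
        forall i, \forall n \near \oo, vabs (u n - x) <=v z i].

End Convergence.

Section Bases.
Context {R : realType} {X : banachLatticeType R}.
Variable C : (nat -> X) -> X -> Prop.
Implicit Types (e : nat -> X) (a : nat -> R).

(* Sequences are indexed from 0, and [series u n] is the sum of the first n
   terms of u. *)
Definition sums_to e a (x : X) : Prop := C (series (fun n => a n *: e n)) x.

Definition is_basis e : Prop := forall x : X, exists! a, sums_to e a x.

Definition is_basis_with e (f : nat -> X -> R) : Prop :=
  is_basis e /\ forall x a, sums_to e a x -> forall k, f k x = a k.

End Bases.

Definition lin_span {R : realType} {X : banachLatticeType R} (e : nat -> X) :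
    set X :=
  [set x | exists (n : nat) (a : nat -> R), x = \sum_(i < n) a i *: e i].

Definition closed_span {R : realType} {X : banachLatticeType R}
  (e : nat -> X) : set X := closure (lin_span e).

(* nat^nat with the product of the discrete topologies *)
Definition baire : topologicalType := prod_topology (fun _ : nat => nat).

(* Boldface Sigma^1_1: projections of closed subsets of baire * baire. *)
Definition analytic (A : set baire) : Prop :=
  exists2 F : set (baire * baire), closed F &
    A = [set p.1 | p in F].

(* In the game with payoff set A the players alternately choose
   x 0, x 1, x 2, ...; the first player chooses the even-indexed terms, and
   wins the run x if and only if A x.  A strategy sends the finite sequence of
   all moves made so far to the next move. *)
Definition strategy : Type := seq nat -> nat.

Definition follows_I (s : strategy) (x : nat -> nat) : Prop :=
  forall n, x n.*2 = s (mkseq x n.*2).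

Definition follows_II (s : strategy) (x : nat -> nat) : Prop :=
  forall n, x n.*2.+1 = s (mkseq x n.*2.+1).

Definition determined (A : set baire) : Prop :=
  (exists s : strategy, forall x : baire, follows_I s x -> A x) \/
  (exists s : strategy, forall x : baire, follows_II s x -> ~ A x).

Definition analytic_determinacy : Prop :=
  forall A : set baire, analytic A -> determined A.

(* Main.v *)
Require Import Defs.
From mathcomp Require Import all_boot all_order all_algebra.
From mathcomp Require Import all_classical all_reals all_analysis.
From mathcomp Require Import lra zify.
Import Order.TTheory GRing.Theory Num.Theory.
Import numFieldNormedType.Exports.
Local Open Scope classical_set_scope.
Local Open Scope ring_scope.
Set Implicit Arguments.
Unset Strict Implicit.
Unset Printing Implicit Defensive.

(** The lattice [X] is separable and its cone is closed, so a decreasing net with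
    infimum 0 contains a decreasing sequence with infimum 0; hence (1) and (2)
    are the same condition.

    The set of pairs consisting of a point [x] and a code for coefficients and
    for a rate of convergence of their series to [x] is coanalytic for each of
    the other three convergences.  Analytic determinacy thus applies to the
    unfolded Banach-Mazur game on [X] in which one player also builds the code.
    That player wins by Baire's theorem, since every point has an expansion, and
    the first digit of the code bounds the [k]-th coefficient.  Playing the
    winning strategy in two runs whose limits differ by an arbitrary small
    vector [h] bounds the [k]-th functional on a ball.

    With continuous functionals, (3) => (4) is immediate.  For (2) => (3), the
    partial sums of each expansion are order bounded, so by Baire's theorem
    their maximal functions are uniformly bounded in norm; approximating [x]
    geometrically fast by finite combinations gives a regulator for uniform
    convergence. *)

(** * Banach lattices *)

Section Lattice.
Context {R : realType} {X : banachLatticeType R}.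
Implicit Types (x y z w : X) (a b : R).

Lemma vle_join_l x y : x <=v vjoin x y.
Proof. by have := vjoin_le x y (vjoin x y); rewrite vle_refl => /esym/andP[]. Qed.

Lemma vle_join_r x y : y <=v vjoin x y.
Proof. by have := vjoin_le x y (vjoin x y); rewrite vle_refl => /esym/andP[]. Qed.

Lemma vle_joinP x y z : x <=v z -> y <=v z -> vjoin x y <=v z.
Proof. by move=> xz yz; rewrite vjoin_le xz yz. Qed.

Lemma vle_eq x y : x <=v y -> y <=v x -> x = y.
Proof. by move=> xy yx; apply: vle_anti; rewrite xy yx. Qed.

Lemma vle_tr y x z : x <=v y -> y <=v z -> x <=v z.
Proof. exact: vle_trans. Qed.

Lemma vleD x y z w : x <=v y -> z <=v w -> x + z <=v y + w.
Proof.
move=> xy zw; apply: (vle_tr (y := x + w)); first exact: vle_add2l.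
by rewrite addrC [y + w]addrC; exact: vle_add2l.
Qed.

Lemma vsubr_ge0 x y : (0 <=v y - x) = (x <=v y).
Proof.
apply/idP/idP => h; first by have := vle_add2l _ _ x h; rewrite addr0 addrC subrK.
by have := vle_add2l _ _ (- x) h; rewrite addNr addrC.
Qed.

Lemma vleBlDr x y z : (x - y <=v z) = (x <=v z + y).
Proof. by rewrite -vsubr_ge0 -[RHS]vsubr_ge0 opprB addrA. Qed.

Lemma vleDlBr x y z : (x + y <=v z) = (x <=v z - y).
Proof. by rewrite -vleBlDr opprK. Qed.

Lemma vleN x y : x <=v y -> - y <=v - x.
Proof. by rewrite -vsubr_ge0 -[in X in _ -> X]vsubr_ge0 opprK addrC. Qed.

Lemma vleZ a x y : 0 <= a -> x <=v y -> a *: x <=v a *: y.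
Proof.
move=> a0; rewrite -vsubr_ge0 -[in X in _ -> X]vsubr_ge0 -scalerBr.
exact: vscale_ge0.
Qed.

Lemma vleZr a b x : a <= b -> 0 <=v x -> a *: x <=v b *: x.
Proof.
by move=> ab x0; rewrite -vsubr_ge0 -scalerBl vscale_ge0 ?subr_ge0.
Qed.

Lemma vle_addr x y : 0 <=v y -> x <=v x + y.
Proof. by move=> y0; rewrite -{1}[x]addr0 vle_add2l. Qed.

Lemma vle_addl x y : 0 <=v y -> x <=v y + x.
Proof. by move=> y0; rewrite addrC vle_addr. Qed.

Lemma vadd_ge0 x y : 0 <=v x -> 0 <=v y -> 0 <=v x + y.
Proof. by move=> x0 y0; rewrite -[0]addr0 vleD. Qed.

Lemma vsum_ge0 (I : Type) (r : seq I) (F : I -> X) :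
  (forall i, 0 <=v F i) -> 0 <=v \sum_(i <- r) F i.
Proof. by move=> F0; elim/big_ind: _ => //; [exact: vle_refl|exact: vadd_ge0]. Qed.

Lemma vle_abs x : x <=v vabs x. Proof. exact: vle_join_l. Qed.

Lemma vleN_abs x : - x <=v vabs x. Proof. exact: vle_join_r. Qed.

Lemma vabs_leP x y : x <=v y -> - x <=v y -> vabs x <=v y.
Proof. exact: vle_joinP. Qed.

Lemma vabs_ge0 x : 0 <=v vabs x.
Proof.
have : 0 <=v 2^-1 *: (vabs x + vabs x).
  apply: vscale_ge0; rewrite ?invr_ge0//.
  by rewrite -(subrr x) vleD ?vle_abs ?vleN_abs.
by rewrite scalerDr -scalerDl [_ + _ : R](_ : _ = 1) ?scale1r//; lra.
Qed.

Lemma ger0_vabs x : 0 <=v x -> vabs x = x.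
Proof.
move=> x0; apply: vle_eq; last exact: vle_abs.
apply: vabs_leP; first exact: vle_refl.
by apply: (vle_tr (y := 0)) => //; have := vleN x0; rewrite oppr0.
Qed.

Lemma vabsN x : vabs (- x) = vabs x.
Proof.
have key (y : X) : vabs (- y) <=v vabs y by apply: vabs_leP; rewrite ?opprK ?vle_abs ?vleN_abs.
by apply: vle_eq => //; rewrite -{1}[x]opprK.
Qed.

Lemma vabsB x y : vabs (x - y) = vabs (y - x).
Proof. by rewrite -vabsN opprB. Qed.

Lemma vabs_triangle x y : vabs (x + y) <=v vabs x + vabs y.
Proof.
by apply: vabs_leP; rewrite ?opprD vleD ?vle_abs ?vleN_abs.
Qed.

Lemma vabsZ_le a x : 0 <= a -> vabs (a *: x) <=v a *: vabs x.
Proof.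
by move=> a0; apply: vabs_leP; rewrite -?scalerN vleZ ?vle_abs ?vleN_abs.
Qed.

Lemma norm_vabs x : `|vabs x| = `|x|.
Proof.
by apply/le_anti/andP; split; apply: vnorm_le; rewrite -!/(vabs _);
  rewrite (ger0_vabs (vabs_ge0 _)) vle_refl.
Qed.

Lemma vnorm_le_abs x y : vabs x <=v vabs y -> `|x| <= `|y|.
Proof. exact: vnorm_le. Qed.

Lemma vnorm_le_pos x y : 0 <=v x -> x <=v y -> `|x| <= `|y|.
Proof.
move=> x0 xy; apply: vnorm_le_abs; rewrite !ger0_vabs//.
exact: vle_tr xy.
Qed.

(** The positive part turns the inequality [x <=v y] into the equation [vpos (x - y) = 0], so
    continuity of [vpos] makes the order closed. *)
Definition vpos x := vjoin x 0.

Lemma vpos_ge0 x : 0 <=v vpos x. Proof. exact: vle_join_r. Qed.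

Lemma vpos_le0 x : x <=v 0 <-> vpos x = 0.
Proof.
split=> [x0|<-]; last exact: vle_join_l.
by apply: vle_eq; [exact: vle_joinP (vle_refl _)|exact: vpos_ge0].
Qed.

Lemma vjoin_pos x y : vjoin x y = vpos (x - y) + y.
Proof.
apply: vle_eq.
  by apply: vle_joinP; rewrite -?vleBlDr ?subrr; [exact: vle_join_l|exact: vpos_ge0].
rewrite vleDlBr.
by apply: vle_joinP; rewrite ?vsubr_ge0 ?vle_join_r// vleD ?vle_join_l ?vle_refl.
Qed.

(** Writing [u = (u - v) + v] gives [vpos u <=v vabs (u - v) + vpos v], and the norm is monotone in
    the absolute value. *)
Lemma vpos_lip x y : `|vpos x - vpos y| <= `|x - y|.
Proof.
have key (u v : X) : vpos u - vpos v <=v vabs (u - v).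
  rewrite vleBlDr; apply: vle_joinP; last by rewrite vadd_ge0 ?vabs_ge0 ?vpos_ge0.
  by rewrite -{1}[u](subrK v) vleD ?vle_abs ?vle_join_l.
apply: vnorm_le_abs; apply: vabs_leP; first exact: key.
by rewrite opprB vabsB; exact: key.
Qed.

Lemma vabs_lip x y : `|vabs x - vabs y| <= `|x - y|.
Proof.
have key (u v : X) : vabs u - vabs v <=v vabs (u - v).
  by rewrite vleBlDr -{1}[u](subrK v) vabs_triangle.
apply: vnorm_le_abs; apply: vabs_leP; first exact: key.
by rewrite opprB vabsB; exact: key.
Qed.

Lemma lip_continuous (f : X -> X) :
  (forall x y, `|f x - f y| <= `|x - y|) -> continuous f.
Proof.
move=> fl x; apply/cvgrPdist_lt => eps eps0; near=> t.
apply: le_lt_trans (fl _ _) _; near: t.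
exact: (@cvgr_dist_lt _ _ _ _ _ id x).
Unshelve. all: by end_near. Qed.

Lemma vpos_continuous : continuous vpos.
Proof. exact/lip_continuous/vpos_lip. Qed.

Lemma vabs_continuous : continuous (@vabs R X).
Proof. exact/lip_continuous/vabs_lip. Qed.

Lemma vjoin_continuous (T : topologicalType) (g h : T -> X) :
  continuous g -> continuous h -> continuous (fun t => vjoin (g t) (h t)).
Proof.
move=> gc hc; rewrite (_ : (fun _ => _) = (fun t => vpos (g t - h t) + h t)).
  move=> t; apply: cvgD; last exact: hc.
  apply: (continuous_comp (f := fun t => g t - h t)); last exact: vpos_continuous.
  by apply: cvgB; [exact: gc|exact: hc].
by apply/funext => t; rewrite vjoin_pos.
Qed.

Lemma closed_vle (T : topologicalType) (g h : T -> X) :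
  continuous g -> continuous h -> closed [set t | g t <=v h t].
Proof.
move=> gc hc.
rewrite (_ : mkset _ = (fun t => vpos (g t - h t)) @^-1` [set 0]).
  apply: preimage_closed.
    move=> t _.
    apply: (continuous_comp (f := fun t => g t - h t)); last exact: vpos_continuous.
    by apply: cvgB; [exact: gc|exact: hc].
  by apply: accessible_closed_set1; exact/hausdorff_accessible/norm_hausdorff.
apply/seteqP; split=> t /=; rewrite -vpos_le0 vleBlDr ?add0r //.
Qed.

Lemma vle_cvg (u v : nat -> X) x y :
  u @ \oo --> x -> v @ \oo --> y -> (\forall n \near \oo, u n <=v v n) -> x <=v y.
Proof.
move=> ux vy uv.
rewrite -[y]add0r -vleBlDr.
apply: (@closed_cvg _ _ \oo _ (fun n => u n - v n) [set z : X | z <=v 0] _ _ _ (cvgB ux vy)).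
  by apply: closed_vle; [move=> ?; exact: cvg_id|exact: cst_continuous].
by near=> n; rewrite /= vleBlDr add0r; near: n.
Unshelve. all: by end_near. Qed.

(** The cone is norm closed and the multiples [z / (m+1)] tend to 0. *)
Lemma varchimedean x z :
  (forall m : nat, x <=v m.+1%:R^-1 *: z) -> x <=v 0.
Proof.
move=> h; apply: (@vle_cvg (fun=> x) (fun m => m.+1%:R^-1 *: z)).
- exact: cvg_cst.
- by rewrite -[0](scale0r z); apply: cvgZr_tmp; exact: cvg_harmonic.
- by near=> m; exact: h.
Unshelve. all: by end_near. Qed.

(** For partial sums these are the truncated maximal functions. Starting from 0 is harmless, all
    entries being absolute values. *)
Fixpoint vmaxs (u : nat -> X) m : X :=
  if m is n.+1 then vjoin (vmaxs u n) (vabs (u n)) else 0.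

Lemma vmaxs_ge0 (u : nat -> X) m : 0 <=v vmaxs u m.
Proof.
by elim: m => [|m ih] /=; [exact: vle_refl|exact: vle_tr (vle_join_l _ _)].
Qed.

Lemma vle_vmaxs (u : nat -> X) m n : (n < m)%N -> vabs (u n) <=v vmaxs u m.
Proof.
elim: m => // m ih; rewrite ltnS leq_eqVlt => /orP[/eqP->|/ih h] /=.
  exact: vle_join_r.
exact: vle_tr (vle_join_l _ _).
Qed.

Lemma vmaxs_le (u : nat -> X) m w :
  0 <=v w -> (forall n, vabs (u n) <=v w) -> vmaxs u m <=v w.
Proof. by move=> w0 uw; elim: m => //= m ih; exact: vle_joinP. Qed.

Lemma vmaxsB (u v : nat -> X) m :
  vmaxs (fun n => u n - v n) m <=v vmaxs u m + vmaxs v m.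
Proof.
elim: m => [|m ih] /=; first by rewrite addr0 vle_refl.
apply: vle_joinP.
  by apply: vle_tr ih _; rewrite vleD ?vle_join_l.
apply: vle_tr (vabs_triangle _ _) _; rewrite vabsN.
by rewrite vleD ?vle_join_r.
Qed.

Lemma vmaxs_continuous (T : topologicalType) (u : nat -> T -> X) m :
  (forall n, continuous (u n)) -> continuous (fun t => vmaxs (u^~ t) m).
Proof.
move=> uc; elim: m => [|m ih] /=; first exact: cst_continuous.
apply: vjoin_continuous => // t.
by apply: (continuous_comp (f := u m)); [exact: uc|exact: vabs_continuous].
Qed.

End Lattice.

(** * The Baire space *)

Lemma pair_continuous (T U V : topologicalType) (f : T -> U) (g : T -> V) :
  continuous f -> continuous g -> continuous (fun t => (f t, g t)).
Proof. by move=> fc gc t; apply: cvg_pair; [exact: fc|exact: gc]. Qed.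

Lemma baire_cyl_nbhs (u : baire) n : nbhs u [set v : baire | mkseq v n = mkseq u n].
Proof.
elim: n => [|n ih]; first exact: filterE.
have un : nbhs u [set v : baire | v n = u n].
  by apply: (@proj_continuous nat (fun=> nat) n u [set k | k = u n]); rewrite nbhs_principalE.
by apply: filterS (filterI ih un) => v [/= h1 h2]; rewrite !mkseqS h1 h2.
Qed.

Lemma baire_nbhs_cyl (u : baire) (U : set baire) :
  nbhs u U -> exists n, forall v : baire, mkseq v n = mkseq u n -> U v.
Proof.
(* The product topology is a supremum of topologies pulled back along the coordinates, so
   convergence of the filter of cylinders to [u] is checked one coordinate at a time. *)
pose F : set_system baire := filter_from [set: nat]
  (fun n => [set v : baire | mkseq v n = mkseq u n]).
have agreeS m n (v w : nat -> nat) : (m <= n)%N ->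
    mkseq v n = mkseq w n -> mkseq v m = mkseq w m.
  by move=> mn /(congr1 (take m)); rewrite -!map_take !take_iota (minn_idPl mn).
have FF : Filter F.
  apply: filter_from_filter; first by exists 0%N.
  move=> m n _ _; exists (maxn m n) => //= v h.
  by split; apply: agreeS h; rewrite ?leq_maxl ?leq_maxr.
suff Fu : F --> (u : baire) by move=> /Fu[n _ h]; exists n.
apply/cvg_sup => i A; rewrite nbhsE => -[B [[C Cop <-] Cu] BA].
exists i.+1 => // v h; apply: BA; rewrite /preimage /=.
by have := congr1 (nth 0%N ^~ i) h; rewrite !nth_mkseq// => ->.
Qed.

Lemma baire_continuous (T : topologicalType) (g : baire -> T) :
  (forall u A, nbhs (g u) A ->
    exists n, forall v : baire, mkseq v n = mkseq u n -> A (g v)) ->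
  continuous g.
Proof.
move=> gP u A /gP[n h]; apply: filterS (baire_cyl_nbhs u n) => v; exact: h.
Qed.

Lemma baire_coord_continuous n : continuous (fun u : baire => u n).
Proof. exact: (@proj_continuous nat (fun=> nat)). Qed.

Lemma baire_reindex_continuous (g h : nat -> nat) :
  continuous (fun u : baire => (fun n => g (u (h n))) : baire).
Proof.
apply: baire_continuous => u A /baire_nbhs_cyl[n An].
(* The first [n] output entries read only input entries up to this maximum. *)
exists (\max_(i < n) h i).+1 => v uv; apply: An.
apply/eq_in_map => i; rewrite mem_iota /= add0n => ilt; congr g.
have := congr1 (nth 0%N ^~ (h i)) uv; rewrite !nth_mkseq//.
all: by rewrite ltnS (leq_bigmax (Ordinal ilt)).
Qed.

(* The first entry of the witness says which disjunct holds: 0 for the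
   projection, and [n.+1] for the cylinder of length [n] missing [K]. *)
Lemma analytic_implies (K : set baire) (L : set (baire * baire)) :
  closed K -> closed L -> analytic [set u | K u -> exists w, L (u, w)].
Proof.
move=> Kcl Lcl.
pose G := [set p : baire * baire | if p.2 0%N is n.+1
  then forall v : baire, mkseq v n = mkseq p.1 n -> ~ K v
  else L (p.1, fun n => p.2 n.+1)].
exists G.
  rewrite -[G]setCK; apply: open_closedC; rewrite openE => -[u p] /=.
  rewrite /G /interior /=; case E : (p 0%N) => [|n].
    move=> nL.
    have ups : nbhs (u, (fun n => p n.+1) : baire) (~` L).
      by apply: open_nbhs_nbhs; split => //; exact: closed_openC.
    have [[U V] /= [Uu Vp] UVL] := ups.
    exists (U, [set p' : baire | p' 0%N = p 0%N] `&` (fun q : baire => (fun n => q n.+1) : baire) @^-1` V) => /=.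
      split => //; apply: filterI.
        by apply: (@baire_coord_continuous 0%N p [set k | k = p 0%N]); rewrite nbhs_principalE.
      exact: (@baire_reindex_continuous id S p).
    by move=> -[u' p'] /= [Uu' [-> Vp']]; rewrite E; apply: (UVL (_, _)).
  move=> /existsNP[v /not_implyP[vu /contrapT Kv]].
  exists ([set u' : baire | mkseq u' n = mkseq u n], [set p' : baire | p' 0%N = p 0%N]) => /=.
    split; first exact: baire_cyl_nbhs.
    by apply: (@baire_coord_continuous 0%N p [set k | k = p 0%N]); rewrite nbhs_principalE.
  by move=> -[u' p'] /= [uu' ->]; rewrite E => /(_ v); apply => //; rewrite vu uu'.
apply/seteqP; split=> [u /= h|_ [[u p] Gup <-]] /=.
  have [Ku|nKu] := pselect (K u).
    by have [w Lw] := h Ku; exists (u, fun n => if n is k.+1 then w k else 0%N).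
  have /baire_nbhs_cyl[n nK] : nbhs u (~` K).
    by apply: open_nbhs_nbhs; split => //; exact: closed_openC.
  by exists (u, fun=> n.+1).
move=> Ku; move: Gup; rewrite /G /=; case: (p 0%N) => [Lp|n /(_ u erefl)//].
by exists (fun n => p n.+1).
Qed.

(** * The unfolded Banach-Mazur game *)

Lemma play_run (f : seq nat -> nat) : exists u, forall n, u n = f (mkseq u n).
Proof.
pose h n := iter n (fun p => rcons p (f p)) [::].
exists (f \o h) => n; congr f.
by elim: n => // n ih; rewrite mkseqS -ih.
Qed.

Lemma norm_harmonic_eq0 (R : realType) (V : normedModType R) (x : V) (C : R) :
  (forall n, `|x| <= C * n.+1%:R^-1) -> x = 0.
Proof.
move=> h; apply/eqP; apply: contraT => x0.
have := h (Num.truncn (C / `|x|)).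
rewrite leNgt => /negP[].
rewrite ltr_pdivrMr// mulrC -ltr_pdivrMr ?normr_gt0//.
exact: truncnS_gt.
Qed.

Lemma small_harmonic (R : realType) (eps : R) : 0 < eps -> exists n, n.+1%:R^-1 < eps.
Proof.
move=> eps0; exists (Num.truncn eps^-1).
by rewrite invf_plt ?posrE// truncnS_gt.
Qed.

(* A move codes a ball with center in the dense sequence and radius 1/(n+1),
   and a natural number.  A ball that is not admissible is replaced by halving
   the current one, so that every sequence of moves is a run. *)
Definition move (c : nat) : nat * nat * nat := odflt (0, 0, 0)%N (unpickle c).

Lemma move_surj a : exists c, move c = a.
Proof. by exists (pickle a); rewrite /move pickleK. Qed.

Section BanachMazur.
Context {R : realType} {V : completeNormedModType R} (q : nat -> V).
Hypothesis q_dense : forall x (eps : R), 0 < eps -> exists n, `|x - q n| < eps.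
Implicit Types (p : seq nat) (u v : nat -> nat).

Let triangle (y x z : V) : `|x - z| <= `|x - y| + `|y - z|.
Proof. exact: ler_distD. Qed.

Let dsym (x y : V) : `|x - y| = `|y - x|.
Proof. exact: distrC. Qed.

(** The first inequality nests the balls, closures included; the second halves the radius, so that
    the centers converge. *)
Definition admissible (B B' : V * R) : bool :=
  (`|B.1 - B'.1| + B'.2 <= B.2) && (B'.2 + B'.2 <= B.2).

Definition next_ball (B : V * R) (c : nat) : V * R :=
  let B' := (q (move c).1.1, (move c).1.2.+1%:R^-1) in
  if admissible B B' then B' else (B.1, B.2 / 2).

Definition pos p : V * R := foldl next_ball (0, 1) p.

Lemma pos_gt0 p : 0 < (pos p).2.
Proof.
elim/last_ind: p => // p c ih; rewrite /pos foldl_rcons /next_ball.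
by case: ifP => _ /=; rewrite ?invr_gt0// divr_gt0.
Qed.

Lemma pos_admissible p c : admissible (pos p) (pos (rcons p c)).
Proof.
rewrite /pos foldl_rcons -/(pos p) /next_ball; case: ifP => //= _.
have p0 := pos_gt0 p; rewrite /admissible /= subrr normr0 add0r.
by apply/andP; split; lra.
Qed.

(** Halving outweighs the passage from [n + 1] to [n + 2]: the product of the radius and [n + 1]
    never increases. *)
Lemma pos_small p : (pos p).2 <= (size p).+1%:R^-1.
Proof.
rewrite -[leRHS]mul1r ler_pdivlMr//.
elim/last_ind: p => [|p c ih]; first by rewrite /= mulr1.
have /andP[_ h] := pos_admissible p c.
apply: le_trans ih; rewrite size_rcons.
have := pos_gt0 (rcons p c); rewrite -!natr1; have : 0 <= (size p)%:R :> R by [].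
nra.
Qed.

Lemma pos_nested u m n : (m <= n)%N ->
  `|(pos (mkseq u m)).1 - (pos (mkseq u n)).1| + (pos (mkseq u n)).2
  <= (pos (mkseq u m)).2.
Proof.
elim: n => [|n ih]; first by rewrite leqn0 => /eqP ->; rewrite subrr normr0 add0r.
rewrite leq_eqVlt => /orP[/eqP->|/ih h]; first by rewrite subrr normr0 add0r.
rewrite mkseqS; have /andP[h' _] := pos_admissible (mkseq u n) (u n).
apply: le_trans h; move: h'.
have := triangle (pos (mkseq u n)).1 (pos (mkseq u m)).1 (pos (rcons (mkseq u n) (u n))).1.
lra.
Qed.

Definition run_lim u : V := lim ((fun n => (pos (mkseq u n)).1) @ \oo).

Lemma run_lim_cvg u : (fun n => (pos (mkseq u n)).1) @ \oo --> run_lim u.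
Proof.
apply/cauchy_cvgP/cauchy_exP => eps eps0.
have [n neps] := small_harmonic eps0.
exists (pos (mkseq u n)).1.
suff : \forall m \near \oo, ball (pos (mkseq u n)).1 eps (pos (mkseq u m)).1 by [].
near=> m; rewrite -ball_normE /=.
have mn : (n <= m)%N by near: m; exact: nbhs_infty_ge.
have h1 := pos_gt0 (mkseq u m); have h2 := pos_nested u mn.
have h3 := pos_small (mkseq u n); rewrite size_mkseq in h3.
apply: le_lt_trans neps; apply: le_trans h3; apply: le_trans h2.
by rewrite lerDl ltW.
Unshelve. all: by end_near.
Qed.

Lemma run_lim_dist u n :
  `|(pos (mkseq u n)).1 - run_lim u| <= (pos (mkseq u n)).2.
Proof.
apply/ler_addgt0Pr => eps eps0.
have /cvgrPdist_lt/(_ eps eps0) lu := @run_lim_cvg u.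
near \oo => m.
have mn : (n <= m)%N by near: m; exact: nbhs_infty_ge.
have h1 : `|run_lim u - (pos (mkseq u m)).1| < eps by near: m.
have h2 := pos_nested u mn; have h3 := pos_gt0 (mkseq u m).
have := triangle (pos (mkseq u m)).1 (pos (mkseq u n)).1 (run_lim u).
by rewrite [X in _ <= _ + X]dsym; lra.
Unshelve. all: by end_near. Qed.

Lemma run_lim_eq u x :
  (forall n, exists2 m, (n <= m)%N & `|(pos (mkseq u m)).1 - x| <= (pos (mkseq u m)).2) ->
  run_lim u = x.
Proof.
move=> h; apply/eqP; rewrite -subr_eq0; apply/eqP.
apply: (@norm_harmonic_eq0 _ _ _ 2) => n.
have [m nm xm] := h n; have lm := run_lim_dist u m.
have /le_trans : `|run_lim u - x| <= 2 * (pos (mkseq u m)).2.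
  have := triangle (pos (mkseq u m)).1 (run_lim u) x.
  by rewrite [X in _ <= X + _]dsym; lra.
apply; rewrite ler_pM2l//; apply: le_trans (pos_small _) _.
by rewrite size_mkseq lef_pV2 ?posrE// ler_nat.
Qed.

Lemma run_lim_close u v n : mkseq v n = mkseq u n ->
  `|run_lim u - run_lim v| <= 2 * n.+1%:R^-1.
Proof.
move=> uv; have hu := run_lim_dist u n; have hv := run_lim_dist v n.
rewrite uv in hv; have h := pos_small (mkseq u n); rewrite size_mkseq in h.
apply: (@le_trans _ _ (2 * (pos (mkseq u n)).2)); last by rewrite ler_pM2l.
have := triangle (pos (mkseq u n)).1 (run_lim u) (run_lim v).
by rewrite [X in _ <= X + _]dsym; lra.
Qed.

Lemma run_lim_continuous : continuous (run_lim : baire -> V).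
Proof.
apply: baire_continuous => u A /nbhs_ballP[eps /= eps0 epsA].
have [n neps] : exists n, n.+1%:R^-1 < eps / 2 :> R by apply: small_harmonic; rewrite divr_gt0.
exists n => v uv; apply: epsA; rewrite -ball_normE /=.
by apply: le_lt_trans (run_lim_close uv) _; rewrite mulrC -ltr_pdivlMr.
Qed.

Definition pos_ball p : set V := ball (pos p).1 (pos p).2.

Lemma pos_ballE p x : pos_ball p x <-> `|(pos p).1 - x| < (pos p).2.
Proof. by rewrite /pos_ball -ball_normE. Qed.

(** Take a center of the dense sequence within the new radius of [x]. Twice this radius is less than
    the slack [del] of [x] in the current ball, which gives admissibility, and less than [eps]. *)
Lemma exists_move p x (eps : R) d : pos_ball p x -> 0 < eps -> exists c,
  [/\ (move c).2 = d, pos_ball (rcons p c) x &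
      `|x - (pos (rcons p c)).1| + (pos (rcons p c)).2 <= eps].
Proof.
move=> /pos_ballE px eps0.
pose del := (pos p).2 - `|(pos p).1 - x|.
have [n] : exists n, n.+1%:R^-1 < Num.min (del / 2) (eps / 2) :> R.
  by apply: small_harmonic; rewrite lt_min !divr_gt0// subr_gt0.
rewrite lt_min => /andP[n1 n2].
have [i xi] : exists i, `|x - q i| < n.+1%:R^-1 by apply: q_dense; rewrite invr_gt0.
have [c cE] := move_surj (i, n, d).
have rho0 : 0 < n.+1%:R^-1 :> R by rewrite invr_gt0.
have := erefl (next_ball (pos p) c); rewrite {2}/next_ball cE /=.
move: (n.+1%:R^-1 : R) n1 n2 xi rho0 => rho n1 n2 xi rho0.
rewrite ifT; last first.
  have := triangle x (pos p).1 (q i); have := normr_ge0 ((pos p).1 - x).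
  rewrite /admissible /= /del in n1 *.
  by move=> *; apply/andP; split; lra.
move=> nE; have posE : pos (rcons p c) = (q i, rho) by rewrite /pos foldl_rcons.
exists c; split; first by rewrite cE.
  by apply/pos_ballE; rewrite posE /= dsym.
rewrite posE /=; lra.
Qed.

(** The starting ball is the open unit ball, and playing only balls around [x] leads to [x]. *)
Lemma run_lim_surj x : `|x| < 1 -> exists u, run_lim u = x.
Proof.
move=> x1.
have /choice[f fP] p : exists c, pos_ball p x -> pos_ball (rcons p c) x.
  have [px|] := pselect (pos_ball p x); last by exists 0%N.
  by have [c [_ h _]] := exists_move 0 px ltr01; exists c.
have [u uE] := play_run f; exists u; apply: run_lim_eq => n; exists n => //.
apply/ltW/pos_ballE; elim: n => [|n ih]; last by rewrite mkseqS uE; exact: fP.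
by apply/pos_ballE; rewrite /= sub0r normrN.
Qed.

(** Runs reach only points of the closed unit ball; the first entry is a scaling factor that makes
    [decode] a continuous map onto the whole space. *)
Definition decode (w : baire) : V := (w 0%N)%:R *: run_lim (fun n => w n.+1).

Lemma decode_continuous : continuous decode.
Proof.
move=> w; apply: (@cvgZ _ _ _ (nbhs w)).
  suff : continuous (fun w : baire => (w 0%N)%:R : R) by exact.
  apply: baire_continuous => u A /nbhs_singleton Au.
  by exists 1%N => v [->].
apply: (continuous_comp (f := fun w : baire => (fun n => w n.+1) : baire)).
  exact: (@baire_reindex_continuous id S).
exact: run_lim_continuous.
Qed.

Lemma decode_surj x : exists w, decode w = x.
Proof.
pose N := (Num.truncn `|x|).+1.
have [u ux] : exists u, run_lim u = N%:R^-1 *: x.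
  apply: run_lim_surj; rewrite normrZ ger0_norm// mulrC ltr_pdivrMr// mul1r.
  exact: truncnS_gt.
exists (fun n => if n is k.+1 then u k else N).
by rewrite /decode /= ux scalerA divff ?scale1r// pnatr_eq0.
Qed.

Lemma mkseq_half2 (u : nat -> nat) n :
  mkseq u n.+1.*2 = rcons (rcons (mkseq u n.*2) (u n.*2)) (u n.*2.+1).
Proof. by rewrite doubleS !mkseqS. Qed.

(** One round: the opponent's move [o], then the answer of [s]. *)
Definition reply (s : strategy) p o := rcons (rcons p o) (s (rcons p o)).

Lemma run_of_chain (s : strategy) (P : nat -> seq nat) :
  P 0%N = [::] -> (forall n, exists o, P n.+1 = reply s (P n) o) ->
  exists2 u, follows_II s u & forall n, mkseq u n.*2 = P n.
Proof.
move=> P0 /choice[ o oP].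
have [u uE] := play_run (fun p => if odd (size p) then s p else o (size p)./2).
have uII : follows_II s u by move=> n; rewrite uE size_mkseq /= odd_double.
exists u => //; elim=> [|n ih]; first by rewrite P0.
by rewrite oP /reply mkseq_half2 uII mkseqS uE size_mkseq odd_double doubleK ih.
Qed.

(** The ball with center [v] and radius [rho] need not be coded by a move; a smaller coded ball
    inside it, containing [v], is played instead. *)
Lemma exists_reply (s : strategy) p (v : V) (rho : R) : 0 < rho ->
  `|v - (pos p).1| + rho <= (pos p).2 ->
  exists o, `|v - (pos (reply s p o)).1| + (pos (reply s p o)).2 <= rho.
Proof.
move=> rho0 h.
have pv : pos_ball p v by apply/pos_ballE; rewrite dsym; lra.
have [ o [_ _ h1]] := exists_move 0 pv rho0; exists o.
have /andP[h2 _] := pos_admissible (rcons p o) (s (rcons p o)).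
have := triangle (pos (rcons p o)).1 v (pos (reply s p o)).1.
rewrite /reply; lra.
Qed.

(** Only the moves of the second player count: these digits form the code built along the run. *)
Definition digits (u : baire) : baire := fun n => (move (u n.*2.+1)).2.

Lemma digits_continuous : continuous digits.
Proof. exact: (@baire_reindex_continuous (fun k => (move k).2) (fun n => n.*2.+1)). Qed.

Lemma open_pos_ball p : open (pos_ball p).
Proof. exact: ball_open. Qed.

(* If player I wins, the set of points that never leave the balls played
   against arbitrary witnesses is residual, and it contains no point having a
   witness. *)
Lemma player_I_cannot_win (W : V -> baire -> Prop) (s : strategy) :
  (forall x, exists y, W x y) ->
  ~ (forall u : baire, follows_I s u -> ~ W (run_lim u) (digits u)).
Proof.
move=> Wtot sI.
pose resp p d : set V := [set x | exists2 c, (move c).2 = d & pos_ball (reply s p c) x].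
(* Adding the exterior of the ball at [p] makes the set dense in the whole space, as Baire's theorem
   requires. *)
pose F k := let pd := odflt ([::], 0%N) (unpickle k) in
  resp pd.1 pd.2 `|` ~` closure (pos_ball pd.1).
have F_open_dense k : open (F k) /\ dense (F k).
  rewrite /F; move: (odflt _ _) => [p d] /=; split.
    apply: openU; last by apply: closed_openC; exact: closed_closure.
    rewrite (_ : resp p d = \bigcup_(c in [set c | (move c).2 = d]) pos_ball (reply s p c)).
      by apply: bigcup_open => c _; exact: open_pos_ball.
    by apply/seteqP; split => x [c]; exists c.
  move=> O [v Ov] Oop.
  have [[v' [pv' Ov']]|nO] := pselect ((pos_ball p `&` O) !=set0); last first.
    exists v; split => //; right => /(_ O) h; apply: nO; apply: h.
    by apply: open_nbhs_nbhs; split.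
  have /nbhs_ballP[eps /= eps0 epsO] : nbhs v' O by apply: open_nbhs_nbhs.
  have e2 : 0 < eps / 2 by rewrite divr_gt0.
  have [c [cd cv hc]] := exists_move d pv' e2.
  exists (pos (reply s p c)).1; split; last first.
    left; exists c => //; apply/pos_ballE; rewrite subrr normr0; exact: pos_gt0.
  apply: epsO; rewrite -ball_normE /=.
  have : `|v' - (pos (reply s p c)).1| < eps; last by [].
  have := triangle (pos (rcons p c)).1 v' (pos (reply s p c)).1.
  have /andP[h2 _] := pos_admissible (rcons p c) (s (rcons p c)).
  have := pos_gt0 (reply s p c); rewrite /reply; lra.
have [x [x0 Fx]] : exists x : V, pos_ball [:: s [::]] x /\ forall k, F k x.
  have [|x [x0 Fx]] := Baire F_open_dense _ (open_pos_ball [:: s [::]]).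
    by exists (pos [:: s [::]]).1; apply/pos_ballE; rewrite subrr normr0; exact: pos_gt0.
  by exists x; split=> // k; exact: Fx.
have step p d : pos_ball p x -> resp p d x.
  move=> px; have := Fx (pickle (p, d)); rewrite /F pickleK /= => -[//|].
  by move=> nx; exfalso; apply/nx/subset_closure.
have [y Wxy] := Wtot x.
(* The second player keeps [x] inside the balls and plays the digits of [y]. Its positions have size
   [2n + 1], whose half is [n]. *)
have /choice[f fP] p : exists c, pos_ball p x ->
    (move c).2 = y (size p)./2 /\ pos_ball (reply s p c) x.
  have [px|] := pselect (pos_ball p x); last by exists 0%N.
  by have [c cd cx] := step p (y (size p)./2) px; exists c.
have [u uE] := play_run (fun p => if odd (size p) then f p else s p).
have uI n : u n.*2 = s (mkseq u n.*2) by rewrite uE size_mkseq odd_double.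
have uf n : u n.*2.+1 = f (mkseq u n.*2.+1) by rewrite uE size_mkseq /= odd_double.
have inv n : pos_ball (mkseq u n.*2.+1) x.
  elim: n => [|n ih]; first by rewrite mkseqS -[u 0%N]/(u 0.*2) uI.
  by rewrite doubleS mkseqS -doubleS uI doubleS mkseqS uf; exact: (fP _ ih).2.
apply: (sI u uI); rewrite (_ : digits u = y).
  rewrite (_ : run_lim u = x) //; apply: run_lim_eq => n; exists n.*2.+1.
    by rewrite -addnn; lia.
  exact/ltW/pos_ballE.
apply/funext => n; rewrite /digits uf (fP _ (inv n)).1 size_mkseq.
by rewrite -[n.*2.+1]/(true + n.*2)%N half_bit_double.
Qed.

(* A winning strategy for player II is played in two runs at once, each run
   providing the balls of player I in the other one up to translation by [h]. *)
Lemma player_II_wins (s : strategy) : exists j r, 0 < r /\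
  forall h, `|h| < r -> exists u v : baire, [/\ follows_II s u, follows_II s v,
    digits u 0%N = j, digits v 0%N = j & run_lim v = run_lim u + h].
Proof.
pose p0 := reply s [::] 0%N.
(* The digit [j] answers the fixed opening move 0, so it does not depend on [h]. *)
exists (move (s [:: 0%N])).2, ((pos p0).2 / 2).
split=> [|h hr]; first by rewrite divr_gt0// pos_gt0.
have r0 : 0 < (pos p0).2 / 2 by rewrite divr_gt0// pos_gt0.
(* The second run moves ahead into the concentric ball of half the radius, which leaves room for the
   shift by [h]. *)
have [ o0 ho0] : exists o, `|(pos p0).1 - (pos (reply s p0 o)).1| +
    (pos (reply s p0 o)).2 <= (pos p0).2 / 2.
  by apply: exists_reply => //; rewrite subrr normr0; lra.
(* The ball of the second run, translated by [- h], lies in the ball of the first; with radii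
   tending to 0 the limits must differ by [h]. *)
pose inv (Q : seq nat * seq nat) :=
  `|(pos Q.2).1 - h - (pos Q.1).1| + (pos Q.2).2 <= (pos Q.1).2.
have /choice[ o oP] Q : exists o : nat * nat, inv Q -> inv (reply s Q.1 o.1, reply s Q.2 o.2).
  have [iQ|] := pselect (inv Q); last by exists (0, 0)%N.
  have [ o1 h1] := exists_reply s (pos_gt0 Q.2) iQ.
  have [|o2 h2] := @exists_reply s Q.2 ((pos (reply s Q.1 o1)).1 + h) _ (pos_gt0 (reply s Q.1 o1)).
    rewrite dsym opprD addrA addrAC; exact: h1.
  exists (o1, o2) => _; rewrite /inv /=.
  by rewrite -addrA -opprD [h + _]addrC dsym; exact: h2.
pose Q n := iter n (fun Q => (reply s Q.1 (o Q).1, reply s Q.2 (o Q).2)) (p0, reply s p0 o0).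
have invQ n : inv (Q n).
  elim: n => [|n ih]; last exact: oP.
  rewrite /inv /=.
  have := triangle ((pos p0).1 - h) ((pos (reply s p0 o0)).1 - h) (pos p0).1.
  have -> : (pos (reply s p0 o0)).1 - h - ((pos p0).1 - h) = (pos (reply s p0 o0)).1 - (pos p0).1.
    by rewrite opprB addrA subrK.
  have -> : (pos p0).1 - h - (pos p0).1 = - h by rewrite addrAC subrr add0r.
  by rewrite normrN [`|(pos (reply _ _ _)).1 - _|]dsym; lra.
have [||u us uQ] := @run_of_chain s (fun n => if n is n.+1 then (Q n).1 else [::]) => //.
  by case=> [|n]; [exists 0%N|exists (o (Q n)).1].
(* The second run is one round ahead, hence the extra position [p0]. *)
have [||v vs vQ] := @run_of_chain s (fun n =>
    if n is n.+1 then if n is n.+1 then (Q n).2 else p0 else [::]) => //.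
  by case=> [|[|n]]; [exists 0%N|exists o0|exists (o (Q n)).2].
exists u, v; split => //.
- rewrite /digits (us 0%N); congr (move (s _)).2.
  by have := congr1 (take 1) (uQ 1%N).
- rewrite /digits (vs 0%N); congr (move (s _)).2.
  by have := congr1 (take 1) (vQ 1%N).
apply/eqP; rewrite -subr_eq0 opprD [- _ - h]addrC addrA; apply/eqP.
apply: (@norm_harmonic_eq0 _ _ _ 2) => n.
have := run_lim_dist u n.+1.*2; have := run_lim_dist v n.+2.*2.
have small := pos_small (mkseq u n.+1.*2); rewrite size_mkseq in small.
move: small; rewrite (uQ n.+1) (vQ n.+2) => small hv hu.
have hQ : (pos (Q n).1).2 <= n.+1%:R^-1.
  apply: le_trans small _; rewrite lef_pV2 ?posrE// ler_nat.
  by rewrite -addnn; lia.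
apply: (@le_trans _ _ (2 * (pos (Q n).1).2)); last by rewrite ler_pM2l.
have := invQ n; rewrite /inv.
have := triangle ((pos (Q n).2).1 - h) (run_lim v - h) (run_lim u).
have -> : run_lim v - h - ((pos (Q n).2).1 - h) = run_lim v - (pos (Q n).2).1.
  by rewrite opprB addrA subrK.
have := triangle (pos (Q n).1).1 ((pos (Q n).2).1 - h) (run_lim u).
by rewrite [`|run_lim v - _|]dsym; lra.
Qed.

(** The first player's payoff consists of the runs whose digits fail to be a witness for the limit,
    an analytic set because [W] is coanalytic. That player cannot win, so determinacy gives the
    second player a winning strategy, along whose runs the digits are always witnesses. *)
Theorem unfolded_game (AD : analytic_determinacy) (K : set (V * baire))
    (L : set (baire * baire)) (W := fun x y => K (x, y) /\ ~ exists w, L (y, w)) :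
  closed K -> closed L -> (forall x, exists y, W x y) ->
  exists j r, 0 < r /\ forall h, `|h| < r -> exists x y y',
    [/\ W x y, W (x + h) y', y 0%N = j & y' 0%N = j].
Proof.
move=> Kcl Lcl Wtot.
have A_analytic : analytic [set u : baire | K (run_lim u, digits u) ->
    exists w, L (digits u, w)].
  apply: (@analytic_implies [set u | K (run_lim u, digits u)]
    [set p | L (digits p.1, p.2)]).
    apply: (@preimage_closed _ _ (fun u : baire => (run_lim u, digits u))) => // u _.
    by apply: pair_continuous; [exact: run_lim_continuous|exact: digits_continuous].
  apply: (@preimage_closed _ _ (fun p : baire * baire => (digits p.1, p.2))) => // p _.
  apply: pair_continuous; last by move=> ?; exact: cvg_snd.
  by move=> r; apply: (cvg_comp _ _ cvg_fst); exact: digits_continuous.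
have [[s sA]|[s sA]] := AD _ A_analytic.
  by case: (@player_I_cannot_win W s Wtot) => u /sA uA [/uA].
have [j [r [r0 hr]]] := player_II_wins s; exists j, r; split => // h /hr.
move=> [u [v [/sA uA /sA vA uj vj uv]]].
exists (run_lim u), (digits u), (digits v); rewrite -uv; split => //.
  by split; [|move=> wL]; apply: contrapT => // nK; apply: uA => //= /nK.
by split; [|move=> wL]; apply: contrapT => // nK; apply: vA => //= /nK.
Qed.

End BanachMazur.

(** * Automatic continuity of coordinate functionals *)

Lemma closed_forall (T : topologicalType) (I : Type) (P : I -> set T) :
  (forall i, closed (P i)) -> closed [set t | forall i, P i t].
Proof.
move=> Pcl; rewrite (_ : mkset _ = \bigcap_i P i); first exact: closed_bigI.
by apply/seteqP; split=> t h => [i _|i]; exact: h.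
Qed.

Lemma closed_imply_nat (T : topologicalType) (N : T -> nat) (A : set nat) (P : set T) :
  continuous N -> closed P -> closed [set t | A (N t) -> P t].
Proof.
move=> Nc Pcl; rewrite (_ : mkset _ = (N @^-1` ~` A) `|` P).
  apply: closedU => //; apply: preimage_closed; first by move=> t _; exact: Nc.
  by rewrite -[~` A]setCK; apply: open_closedC; exact: discrete_open.
apply/seteqP; split => t /=; last by case.
by move=> h; have [/h|] := pselect (A (N t)); [right|left].
Qed.

Lemma closed_ler (R : realType) (T : topologicalType) (g h : T -> R) :
  continuous g -> continuous h -> closed [set t | g t <= h t].
Proof.
move=> gc hc; rewrite (_ : mkset _ = (fun t => h t - g t) @^-1` [set x | 0 <= x]).
  apply: preimage_closed; last exact: closed_ge.
  by move=> t _; apply: (@cvgB _ R); [exact: hc|exact: gc].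
by apply/seteqP; split => t /=; rewrite subr_ge0.
Qed.

Lemma near_oo_choice (P : nat -> nat -> Prop) :
  (forall m, \forall n \near \oo, P m n) <->
  exists N, forall m n, (N m <= n)%N -> P m n.
Proof.
split=> [h|[N h] m]; last by exists (N m) => // n; exact: h.
suff /choice[N NP] m : exists N, forall n, (N <= n)%N -> P m n by exists N.
by have [N _ NP] := h m; exists N.
Qed.

(** * Separability and the replacement of nets by sequences *)

Section Separable.
Context {R : realType} {X : banachLatticeType R}.
Implicit Types (e : nat -> X).

Definition rational_span e (k : nat) : X :=
  let s : seq rat := odflt [::] (unpickle k) in \sum_(i < size s) ratr s`_i *: e i.

Lemma rational_span_dense e : closed_span e = [set: X] ->
  forall x (eps : R), 0 < eps -> exists k, `|x - rational_span e k| < eps.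
Proof.
move=> eT.
have key n (a : nat -> R) eps : 0 < eps -> exists s : seq rat, size s = n /\
    `|\sum_(i < n) a i *: e i - \sum_(i < n) ratr s`_i *: e i| < eps.
  elim: n eps => [|n ih] eps eps0.
    by exists [::]; rewrite !big_ord0 subrr normr0.
  have e2 : 0 < eps / 2 by rewrite divr_gt0.
  have [s [sn hs]] := ih _ e2.
  pose del := eps / 2 / (`|e n| + 1).
  have en : 0 < `|e n| + 1 by rewrite ltr_wpDl.
  have del0 : 0 < del by rewrite divr_gt0.
  have [r] := @rat_in_itvoo _ (a n - del) (a n + del) ltac:(lra).
  rewrite in_itv /= => /andP[r1 r2].
  exists (rcons s r); split; first by rewrite size_rcons sn.
  rewrite !big_ord_recr /= nth_rcons sn ltnn eqxx.
  rewrite [X in _ - (X + _)](_ : _ = \sum_(i < n) ratr s`_i *: e i); last first.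
    by apply: eq_bigr => i _; rewrite nth_rcons sn ltn_ord.
  rewrite opprD addrACA -scalerBl (le_lt_trans (ler_normD _ _))//.
  rewrite [ltRHS]splitr ltr_leD// normrZ.
  apply: (@le_trans _ _ (del * `|e n|)).
    by rewrite ler_wpM2r// ltW// ltr_distl; apply/andP; split; lra.
  by rewrite /del mulrAC ler_pdivrMr// ler_wpM2l ?lerDl// ltW.
move=> x eps eps0; have e2 : 0 < eps / 2 by rewrite divr_gt0.
have : closed_span e x by rewrite eT.
move=> /(_ _ (nbhsx_ballx x _ e2))[_ [[n [a ->]]]].
rewrite -ball_normE /= => xa.
have [s [sn hs]] := key n a _ e2.
exists (pickle s); rewrite /rational_span pickleK /= sn.
rewrite [ltRHS]splitr; apply: le_lt_trans (ler_distD _ _ _) _; exact: ltrD xa hs.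
Qed.

(** The range of the net is norm separable, so countably many indices [c k] give a dense part of it.
    Directedness yields a chain [d] passing above all of them. A lower bound of [z] along [d] is
    below every [z (c k)], hence below every [z i] because the order is closed. *)
Lemma order_cvgP (q : nat -> X) : (forall x (eps : R), 0 < eps -> exists n, `|x - q n| < eps) ->
  forall (u : nat -> X) x, order_cvg u x <-> sigma_order_cvg u x.
Proof.
move=> q_dense u x; split=> [[I [leI [z [[[i0] refl trans dir] zdec [zge zinf] zcv]]]]|]; last first.
  move=> [z [zdec zinf zcv]]; exists nat, leq, z; split => //.
  split=> [|//|i j k|i j]; [exact: (inhabits 0%N)| exact: leq_trans|].
  by exists (maxn i j); rewrite leq_maxl leq_maxr.
(* [c] lists the indices of a norm dense sequence in the range of [z]. *)
have /choice[c cP] (k : nat) : exists i, let nm := odflt (0, 0)%N (unpickle k) in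
    (exists i', `|z i' - q nm.1| < nm.2.+1%:R^-1) -> `|z i - q nm.1| < nm.2.+1%:R^-1.
  set nm := odflt _ _ => /=.
  by have [[i' h]|nh] := pselect (exists i', `|z i' - q nm.1| < nm.2.+1%:R^-1); [exists i'|exists i0].
have /choice[up upP] (ik : I * nat) : exists j, leI ik.1 j /\ leI (c ik.2) j by exact: dir.
pose d := fix d n := if n is k.+1 then up (d k, k) else i0.
have dS n : leI (d n) (d n.+1) /\ leI (c n) (d n.+1) by exact: (upP (d n, n)).
have dle m n : (m <= n)%N -> leI (d m) (d n).
  elim: n => [|n ih]; first by rewrite leqn0 => /eqP->.
  rewrite leq_eqVlt => /orP[/eqP->//|/ih h]; exact: trans h (dS n).1.
exists (z \o d); split=> [m n mn||m]; [exact/zdec/dle|split=> [m|w wz]; first exact: zge|exact: zcv].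
apply: zinf => i.
have wc k : w <=v z (c k) by apply: vle_tr (wz k.+1) _; exact: zdec (dS k).2.
have /choice[k kP] m : exists k, `|z i - z (c k)| < 2 * m.+1%:R^-1.
  have [n zn] : exists n, `|z i - q n| < m.+1%:R^-1 by apply: q_dense; rewrite invr_gt0.
  exists (pickle (n, m)); have := cP (pickle (n, m)); rewrite pickleK /= => h.
  have {}h := h (ex_intro _ i zn).
  rewrite mulr_natl mulr2n; apply: le_lt_trans (ler_distD (q n) _ _) _.
  by apply: ltrD => //; rewrite distrC.
apply: (@vle_cvg _ _ (fun=> w) (fun m => z (c (k m)))); first exact: cvg_cst.
  apply/cvgrPdist_lt => eps eps0; near=> m.
  apply: lt_trans (kP m) _; rewrite mulrC -ltr_pdivlMr//.
  by near: m; exact: (near_infty_natSinv_lt (PosNum (divr_gt0 eps0 (ltr0n _ 2)))).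
by near=> m; exact: wc.
Unshelve. all: by end_near. Qed.

End Separable.

(** * Coding of expansions by points of the Baire space *)

Section Coordinates.
Context {R : realType} {X : banachLatticeType R} (e : nat -> X).
Hypothesis e_total : closed_span e = [set: X].
Implicit Types (C : (nat -> X) -> X -> Prop) (y w : baire).

Let q := rational_span e.
Let q_dense := rational_span_dense e_total.

Let qR (k : nat) : R := ratr (odflt 0 (unpickle k)).

Let qR_dense (x eps : R) : 0 < eps -> exists k, `|x - qR k| < eps.
Proof.
move=> eps0; have [r] := @rat_in_itvoo _ (x - eps) (x + eps) ltac:(lra).
rewrite in_itv /= => /andP[r1 r2]; exists (pickle r); rewrite /qR pickleK /=.
by rewrite ltr_distl; apply/andP; split; lra.
Qed.

(* A witness [y] codes a bound [y 0] and, in columns, a sequence of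
   coefficients, a sequence of vectors and a sequence of integers. *)
Let column (t n : nat) y : baire := fun i => y (pickle (t, n, i)).+1.
Let coef (n : nat) y : R := decode (V := R) qR (column 0%N n y).
Let bnd (m : nat) y : X := decode q (column 1%N m y).
Let thr (m : nat) y : nat := y (pickle (2%N, m, 0%N)).+1.
(** Entry 0 of [w] is reserved for the integer certifying that [vec w] is nonzero. *)
Let vec w : X := decode q (fun i => w i.+1).

Let column_continuous t n : continuous (column t n).
Proof. exact: (@baire_reindex_continuous id (fun i => (pickle (t, n, i)).+1)). Qed.

Let coef_continuous n : continuous (coef n).
Proof.
move=> y; apply: (continuous_comp (f := column 0%N n)); first exact: column_continuous.
exact: (@decode_continuous R R qR).
Qed.

Let bnd_continuous m : continuous (bnd m).
Proof.
move=> y; apply: (continuous_comp (f := column 1%N m)); first exact: column_continuous.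
exact: decode_continuous.
Qed.

Let vec_continuous : continuous vec.
Proof.
move=> w; apply: (continuous_comp (f := (fun w => (fun i => w i.+1)) : baire -> baire)).
  exact: (@baire_reindex_continuous id S).
exact: decode_continuous.
Qed.

Let code j (a : nat -> R) (z : nat -> X) (N : nat -> nat) :
  exists y, [/\ y 0%N = j, forall n, coef n y = a n, forall m, bnd m y = z m &
    forall m, thr m y = N m].
Proof.
have /choice[wa waE] n : exists w, decode (V := R) qR w = a n by exact: decode_surj.
have /choice[wz wzE] n : exists w, decode q w = z n by exact: (decode_surj q_dense).
pose f (tni : nat * nat * nat) := let: (t, n, i) := tni in
  if t is t'.+1 then if t' is 0 then wz n i else N n else wa n i.
exists (fun k => if k is l.+1 then f (odflt (0, 0, 0)%N (unpickle l)) else j).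
split => // n.
- by rewrite -waE; congr decode; apply/funext => i; rewrite /column pickleK.
- by rewrite -wzE; congr decode; apply/funext => i; rewrite /column pickleK.
- by rewrite /thr pickleK.
Qed.

(** All clauses are closed in codes for [z] and [N] except [is_vinf z 0], which quantifies over all
    vectors and makes the relation coanalytic. Closedness is stated along continuous maps so that it
    can be pulled back to codes. *)
Definition parametrized C := exists (E : nat -> X -> X -> Prop) (H : (nat -> X) -> Prop),
  [/\ forall m (T : topologicalType) (g h : T -> X), continuous g -> continuous h ->
        closed [set t | E m (g t) (h t)],
      forall (T : topologicalType) (z : nat -> T -> X), (forall m, continuous (z m)) ->
        closed [set t | H (z^~ t)] &
      forall u x, C u x <-> exists z N,
        [/\ H z, is_vinf z 0 & forall m n, (N m <= n)%N -> E m (u n - x) (z m)]].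

(** A lower bound [w] of positive vectors may be replaced by [vpos w]. The integer [j] expresses
    nonvanishing of [v] by a closed condition. *)
Lemma vinf_zeroP (z : nat -> X) : is_vinf z 0 <->
  (forall m, 0 <=v z m) /\
  ~ exists j v, [/\ 0 <=v v, forall m, v <=v z m & 1 <= `|v| * j%:R].
Proof.
split=> [[z0 zinf]|[z0 nv]].
  split=> // -[j [v [v0 vz]]].
  have -> : v = 0 by apply: vle_eq => //; exact: zinf.
  by rewrite normr0 mul0r ler10.
split=> // w wz; apply/vpos_le0; apply: contrapT => /eqP p0; apply: nv.
exists (Num.truncn `|vpos w|^-1).+1, (vpos w); split.
- exact: vpos_ge0.
- by move=> m; exact: vle_joinP.
by rewrite mulrC -ler_pdivrMr ?normr_gt0// div1r ltW// truncnS_gt.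
Qed.

(** [K] gathers the closed conditions on a code, among them the bound [y 0] on its [k]-th
    coefficient, and [L] the refutations of infimum 0. The game then yields codes with the same
    bound [j] for some [x] and [x + h]. *)
Lemma coordinate_continuous (AD : analytic_determinacy) C (es : nat -> {scalar X}) k :
  parametrized C -> is_basis_with C e (fun k => es k) -> continuous (es k).
Proof.
move=> [E [H [Ecl Hcl CP]]] [Cbasis Ces].
pose K : set (X * baire) := [set p | [/\ `|coef k p.2| <= (p.2 0%N)%:R,
  H (fun m => bnd m p.2), forall m, 0 <=v bnd m p.2 &
  forall m n, (thr m p.2 <= n)%N ->
    E m (series (fun i => coef i p.2 *: e i) n - p.1) (bnd m p.2)]].
pose L : set (baire * baire) := [set p | [/\ 0 <=v vec p.2,
  forall m, vec p.2 <=v bnd m p.1 & 1 <= `|vec p.2| * (p.2 0%N)%:R]].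
have fstc (S T : topologicalType) : continuous (fst : S * T -> S) by move=> ?; exact: cvg_fst.
have sndc (S T : topologicalType) : continuous (snd : S * T -> T) by move=> ?; exact: cvg_snd.
have compc (S T U : topologicalType) (g : T -> U) (f : S -> T) :
  continuous f -> continuous g -> continuous (fun s => g (f s)).
  by move=> fc gc s; apply: (continuous_comp (f := f)); [exact: fc|exact: gc].
have natc : continuous (fun n : nat => n%:R : R).
  by move=> n A /nbhs_singleton An; rewrite nbhs_principalE /= => ? ->.
have c0 : continuous (fun y : baire => (y 0%N)%:R : R).
  exact: (compc _ _ _ _ _ (@baire_coord_continuous 0%N) natc).
have normc : continuous (fun x : X => `|x| : R) by exact: norm_continuous.
have Kcl : closed K.
  rewrite (_ : K = [set p | `|coef k p.2| <= (p.2 0%N)%:R] `&`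
    [set p | H (fun m => bnd m p.2)] `&` [set p | forall m, 0 <=v bnd m p.2] `&`
    [set p | forall m n, (thr m p.2 <= n)%N ->
      E m (series (fun i => coef i p.2 *: e i) n - p.1) (bnd m p.2)]); last first.
    by apply/seteqP; split=> p; [case|case=> [[[]]]].
  have bc m : continuous (fun p : X * baire => bnd m p.2) by exact: (compc _ _ _ _ _ (@sndc _ _) (@bnd_continuous m)).
  apply: closedI; [apply: closedI; [apply: closedI|]|].
  - apply: closed_ler; last exact: (compc _ _ _ _ _ (@sndc _ _) c0).
    apply: (compc _ _ _ (fun x : R => `|x|)); last exact: norm_continuous.
    exact: (compc _ _ _ _ _ (@sndc _ _) (@coef_continuous k)).
  - exact: Hcl.
  - by apply: closed_forall => m; apply: closed_vle => //; exact: cst_continuous.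
  apply: closed_forall => m; apply: closed_forall => n.
  apply: (@closed_imply_nat _ (fun p : X * baire => thr m p.2) (fun N => (N <= n)%N)).
    exact: (compc _ _ _ _ _ (@sndc _ _) (@baire_coord_continuous _)).
  apply: Ecl => //; move=> p; apply: cvgB; last exact: fstc.
  rewrite /series /=.
  apply: cvg_big => [|i _]; first exact: add_continuous.
  apply: cvgZr_tmp.
  exact: (compc _ _ _ _ _ (@sndc _ _) (@coef_continuous i)).
have Lcl : closed L.
  rewrite (_ : L = [set p | 0 <=v vec p.2] `&` [set p | forall m, vec p.2 <=v bnd m p.1] `&`
    [set p | 1 <= `|vec p.2| * (p.2 0%N)%:R]); last first.
    by apply/seteqP; split=> p; [case|case=> [[]]].
  have vc : continuous (fun p : baire * baire => vec p.2) by exact: (compc _ _ _ _ _ (@sndc _ _) vec_continuous).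
  apply: closedI; [apply: closedI|].
  - by apply: closed_vle => //; exact: cst_continuous.
  - apply: closed_forall => m; apply: closed_vle => //.
    exact: (compc _ _ _ _ _ (@fstc _ _) (@bnd_continuous m)).
  apply: closed_ler; first exact: cst_continuous.
  move=> p; apply: cvgM; first exact: (compc _ _ _ _ _ vc normc).
  exact: (compc _ _ _ _ _ (@sndc _ _) c0).
have Wtot x : exists y, K (x, y) /\ ~ exists w, L (y, w).
  have [a [ax _]] := Cbasis x; have [z [N [Hz zinf zE]]] := (CP _ _).1 ax.
  have [y [y0 ya yz yN]] := code (Num.truncn `|a k|).+1 a z N.
  have [z0 nv] := (vinf_zeroP z).1 zinf.
  exists y; split.
    split=> /=.
    - by rewrite ya y0 ltW// truncnS_gt.
    - by rewrite (_ : (fun m => _) = z)//; exact/funext.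
    - by move=> m; rewrite yz.
    - move=> m n; rewrite yN yz => /zE; congr (E m (series _ n - x) (z m)).
      by apply/funext => i; rewrite ya.
  move=> [w [v0 vz vn]]; apply: nv; exists (w 0%N), (vec w); split => // m.
  by rewrite -yz.
have Wbound x y : K (x, y) /\ (~ exists w, L (y, w)) -> `|es k x| <= (y 0%N)%:R.
  move=> [[h1 h2 h3 h4] nL]; rewrite (Ces x (coef^~ y)) //.
  apply/CP; exists (bnd^~ y), (thr^~ y); split => //.
  apply/vinf_zeroP; split=> // -[j [v [v0 vz vj]]]; apply: nL.
  have [w wv] := decode_surj q_dense v.
  by exists (fun n => if n is i.+1 then w i else j); split; rewrite /vec /= wv.
have [j [r [r0 hr]]] := unfolded_game q_dense AD Kcl Lcl Wtot.
(* [es k h] is the difference of the values at [x + h] and [x], each at most [j] in absolute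
   value. *)
have es_bounded h : `|h| < r -> `|es k h| <= 2 * j%:R.
  move=> /hr[x [y [y' [/Wbound xy /Wbound xy' yj y'j]]]].
  rewrite yj in xy; rewrite y'j raddfD in xy'.
  have : `|es k h| <= `|es k x + es k h| + `|es k x|.
    by have := ler_normB (es k x + es k h) (es k x); rewrite addrAC subrr add0r.
  by lra.
apply: (@bounded_linear_continuous _ X R^o (es k)).
apply/ex_bound; exists (2 * j%:R); by apply/nbhs_norm0P; exists r.
Qed.

End Coordinates.

(** * Comparison of the convergences *)

Section Convergences.
Context {R : realType} {X : banachLatticeType R}.
Implicit Types (u : nat -> X) (x : X).

Lemma vinf_scale (z : X) : 0 <=v z -> is_vinf (fun m => m.+1%:R^-1 *: z) 0.
Proof. by move=> z0; split=> [m|w]; [exact: vscale_ge0|exact: varchimedean]. Qed.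

Lemma uniform_cvgP u x : uniform_cvg u x <-> exists2 z, 0 <=v z &
  forall m, \forall n \near \oo, vabs (u n - x) <=v m.+1%:R^-1 *: z.
Proof.
split=> -[z z0 h]; exists z => //; first by move=> m; exact: h.
by case=> // m _; exact: h.
Qed.

Lemma uniform_sigma_order_cvg u x : uniform_cvg u x -> sigma_order_cvg u x.
Proof.
move=> /uniform_cvgP[z z0 h]; exists (fun m => m.+1%:R^-1 *: z); split => //.
  by move=> m n mn; apply: vleZr => //; rewrite lef_pV2 ?posrE// ler_nat.
exact: vinf_scale.
Qed.

Lemma norm_cvgP u x : norm_cvg u x <->
  forall m, \forall n \near \oo, `|u n - x| <= m.+1%:R^-1.
Proof.
split=> [/cvgrPdist_le ux m|h].
  by near=> n; rewrite distrC; near: n; apply: ux; rewrite invr_gt0.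
apply/cvgrPdist_lt => eps eps0; have [m meps] := small_harmonic eps0.
by near=> n; apply: le_lt_trans meps; rewrite distrC; near: n; exact: h.
Unshelve. all: by end_near. Qed.

Lemma uniform_norm_cvg u x : uniform_cvg u x -> norm_cvg u x.
Proof.
move=> /uniform_cvgP[z z0 h]; apply/cvgrPdist_lt => eps eps0.
have [m meps] : exists m, m.+1%:R^-1 < eps / (`|z| + 1).
  by apply: small_harmonic; rewrite divr_gt0// ltr_wpDl.
near=> n; rewrite distrC -norm_vabs.
have : vabs (u n - x) <=v m.+1%:R^-1 *: z by near: n; exact: h.
move=> /(vnorm_le_pos (vabs_ge0 _))/le_lt_trans; apply.
rewrite normrZ ger0_norm//; apply: (@le_lt_trans _ _ (m.+1%:R^-1 * (`|z| + 1))).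
  by rewrite ler_wpM2l// lerDl.
by rewrite -ltr_pdivlMr// ltr_wpDl.
Unshelve. all: by end_near. Qed.

Lemma parametrized_sigma_order : parametrized (@sigma_order_cvg R X).
Proof.
exists (fun _ d z => vabs d <=v z), (fun z => forall m n, (m <= n)%N -> z n <=v z m).
split=> [_ T g h gc hc|T z zc|u x].
- apply: closed_vle => // t.
  by apply: (continuous_comp (f := g)); [exact: gc|exact: vabs_continuous].
- do 3 apply: closed_forall => ?; exact: closed_vle.
split=> [[z [zdec zinf /(near_oo_choice (fun m n => vabs (u n - x) <=v z m))[N NP]]]|].
  by exists z, N.
move=> [z [N [zdec zinf NP]]]; exists z; split=> // m.
by exists (N m) => // n; exact: NP.
Qed.

(** The regulator is stored as [z 0]; bounding the other entries by its multiples is a closed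
    condition. *)
Lemma parametrized_uniform : parametrized (@uniform_cvg R X).
Proof.
exists (fun _ d z => vabs d <=v z), (fun z => forall m, z m <=v m.+1%:R^-1 *: z 0%N).
split=> [_ T g h gc hc|T z zc|u x].
- apply: closed_vle => // t.
  by apply: (continuous_comp (f := g)); [exact: gc|exact: vabs_continuous].
- apply: closed_forall => m; apply: closed_vle => // t.
  by apply: cvgZl_tmp; exact: zc.
rewrite uniform_cvgP; split.
  move=> [z z0 /(near_oo_choice (fun m n => vabs (u n - x) <=v m.+1%:R^-1 *: z))[N NP]].
  exists (fun m => m.+1%:R^-1 *: z), N; split=> //; last exact: vinf_scale.
  by move=> m; rewrite invr1 scale1r vle_refl.
move=> [z [N [zle [z0 _] NP]]]; exists (z 0%N) => // m.
by exists (N m) => // n /NP /vle_tr; apply.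
Qed.

Lemma parametrized_norm : parametrized (@norm_cvg R X).
Proof.
exists (fun m d _ => `|d| <= m.+1%:R^-1), (fun=> True).
split=> [m T g h gc hc|T z zc|u x].
- apply: closed_ler; last exact: cst_continuous.
  by move=> t; apply: (continuous_comp (f := g)); [exact: gc|exact: norm_continuous].
- rewrite (_ : mkset _ = setT); first exact: closedT.
  by apply/seteqP.
rewrite norm_cvgP (near_oo_choice (fun m n => `|u n - x| <= m.+1%:R^-1)).
split=> [[N NP]|[z [N [_ _ NP]]]]; last by exists N.
(* The rates being the numbers [1/(m+1)], the zero sequence serves as [z]. *)
exists (fun=> 0), N; split=> //; split=> [_|w]; first exact: vle_refl.
by move=> /(_ 0%N).
Qed.

End Convergences.

(** * Maximal functions of order bounded partial sums *)

Section OrderBounded.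
Context {R : realType} {X : banachLatticeType R}.
Variables (e : nat -> X) (es : nat -> {scalar X}).
Hypothesis e_total : closed_span e = [set: X].
Hypothesis e_biorth : forall k n : nat, es k (e n) = (k == n)%:R.
Hypothesis es_continuous : forall k, continuous (es k).

Definition partial_sum n x : X := series (fun i => es i x *: e i) n.

Lemma partial_sumB n x y : partial_sum n (x - y) = partial_sum n x - partial_sum n y.
Proof.
by rewrite /partial_sum /series /= -sumrB; apply: eq_bigr => i _; rewrite raddfB scalerBl.
Qed.

Lemma partial_sumZD n a x y : partial_sum n (a *: x + y) = a *: partial_sum n x + partial_sum n y.
Proof.
rewrite /partial_sum /series /= scaler_sumr -big_split; apply: eq_bigr => i _ /=.
by rewrite linearP scalerDl scalerA.
Qed.

Lemma partial_sum_continuous n : continuous (partial_sum n).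
Proof.
move=> x; apply: cvg_big => [|i _]; first exact: add_continuous.
by apply: cvgZr_tmp; exact: es_continuous.
Qed.

Lemma partial_sum_e l n : (l < n)%N -> partial_sum n (e l) = e l.
Proof.
move=> ln; rewrite /partial_sum /series /= (bigD1_seq l) ?iota_uniq ?mem_index_iota//=.
rewrite e_biorth eqxx scale1r big1 ?addr0// => i il.
by rewrite e_biorth (negbTE il) scale0r.
Qed.

(** By biorthogonality [partial_sum n] fixes [e l] for all [l < n]. *)
Lemma partial_sum_span y : lin_span e y -> exists L, forall n, (L <= n)%N -> partial_sum n y = y.
Proof.
move=> [l [a ->]]; exists l => n ln.
suff key k : (k <= l)%N ->
  partial_sum n (\sum_(i < k) a i *: e i) = \sum_(i < k) a i *: e i by exact: key.
elim: k => [|k ih] kl.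
  by rewrite big_ord0 -[in LHS](subrr (0 : X)) partial_sumB subrr.
rewrite big_ord_recr /= addrC partial_sumZD ih ?(ltnW kl)//.
by rewrite partial_sum_e// (leq_trans kl).
Qed.

Hypothesis order_bounded : forall x, exists u, forall n, vabs (partial_sum n x) <=v u.

(** The closed sets where the maximal functions are bounded by [M] cover [X], so by Baire's theorem
    one of them contains a ball about some [c]. Writing [h] as the difference of [c + h] and [c]
    doubles the bound. *)
Lemma maximal_bounded : exists (M r : R), 0 < r /\ forall h, `|h| < r ->
  forall m, `|vmaxs (partial_sum^~ h) m| <= M.
Proof.
pose F (M : nat) : set X := ~` [set x | forall m, `|vmaxs (partial_sum^~ x) m| <= M%:R].
have F_open M : open (F M).
  apply: closed_openC; apply: closed_forall => m; apply: closed_ler; last exact: cst_continuous.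
  move=> x; apply: (continuous_comp (f := fun x => vmaxs (partial_sum^~ x) m)); last exact: norm_continuous.
  by apply: vmaxs_continuous => n; exact: partial_sum_continuous.
have [M] : exists M, ~ dense (F M).
  apply/existsNP => Fd.
  have [||x [_ Fx]] := @Baire R X F (fun M => conj (F_open M) (Fd M)) setT; first by exists 0.
    exact: openT.
  have [u xu] := order_bounded x.
  have u0 : 0 <=v u by exact: vle_tr (vabs_ge0 _) (xu 0%N).
  apply: (Fx (Num.truncn `|u|).+1) => // m; rewrite ltW//; apply: le_lt_trans (truncnS_gt _).
  by apply: vnorm_le_pos; [exact: vmaxs_ge0|exact: vmaxs_le].
move=> /denseNE[U [[c [Uop Uc]] UF0]].
have /nbhs_ballP[r /= r0 rU] : nbhs c U by apply: open_nbhs_nbhs.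
have bnd x : U x -> forall m, `|vmaxs (partial_sum^~ x) m| <= M%:R.
  by move=> Ux; apply: contrapT => nx; have : (U `&` F M) x by []; rewrite UF0.
exists (M%:R + M%:R), r; split=> // h hr m.
have Uch : U (c + h).
  by apply: rU; rewrite -ball_normE /= opprD addrA subrr add0r normrN.
apply: le_trans (lerD (bnd _ Uch m) (bnd _ Uc m)).
apply: le_trans (ler_normD _ _); apply: vnorm_le_pos; first exact: vmaxs_ge0.
rewrite (_ : partial_sum^~ h = fun n => partial_sum n (c + h) - partial_sum n c).
  exact: vmaxsB.
by apply/funext => n; rewrite -partial_sumB addrAC subrr add0r.
Qed.

(* [x] is a limit of [y j] in the span with norm [x - y j] of order [4^-j], so that
   the [4^j (y (j+1) - y j)] have dominated maximal functions and the error of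
   [y i] is a [2^-i] fraction of one convergent sum. *)
Lemma order_bounded_uniform_cvg x : uniform_cvg (partial_sum^~ x) x.
Proof.
have [M [r [r0 Mr]]] := maximal_bounded.
(* The first bound makes the rescaled differences [t j] shorter than [r]; the second gives
   convergence of [y]. *)
have /choice[y yP] (j : nat) : exists y, lin_span e y /\
    `|x - y| < Num.min (r / 2 / 4 ^+ j) (j.+1%:R^-1).
  set eps := Num.min _ _.
  have eps0 : 0 < eps by rewrite lt_min invr_gt0 ltr0Sn !divr_gt0// exprn_gt0.
  have : closed_span e x by rewrite e_total.
  move=> /(_ _ (nbhsx_ballx x _ eps0))[y [ys xy]]; exists y; split=> //.
  by move: xy; rewrite -ball_normE.
have ycvg : y @ \oo --> x.
  apply/norm_cvgP => m; near=> n; rewrite distrC ltW//.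
  have [_] := yP n; rewrite lt_min => /andP[_ /lt_le_trans]; apply.
  rewrite lef_pV2 ?posrE// ler_nat ltnS; near: n; exact: nbhs_infty_ge.
pose t (j : nat) : X := 4 ^+ j *: (y j.+1 - y j).
have tr (j : nat) : `|t j| < r.
  have p4 : 0 < 4 ^+ j :> R by rewrite exprn_gt0.
  rewrite normrZ ger0_norm ?ltW// mulrC -ltr_pdivlMr//.
  have [_] := yP j; have [_] := yP j.+1; rewrite !lt_min => /andP[h1 _] /andP[h2 _].
  have h3 : r / 2 / 4 ^+ j.+1 <= r / 2 / 4 ^+ j.
    rewrite ler_pM2l ?divr_gt0// lef_pV2 ?posrE ?exprn_gt0// ler_weXn2l ?ler1n//.
  apply: le_lt_trans (ler_distD x _ _) _; rewrite [X in X + _]distrC.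
  apply: lt_le_trans (ltrD h1 h2) _.
  have -> : r / 4 ^+ j = r / 2 / 4 ^+ j + r / 2 / 4 ^+ j by rewrite -mulrDl -splitr.
  by rewrite lerD2r.
have /choice[L LP] (j : nat) : exists L, forall n, (L <= n)%N -> partial_sum n (y j) = y j.
  exact: partial_sum_span (yP j).1.
pose K (j : nat) := maxn (L j) (L j.+1).
have tfix j n : (K j <= n)%N -> partial_sum n (t j) = t j.
  rewrite geq_max => /andP[n1 n2]; rewrite -[t j]addr0 partial_sumZD.
  rewrite partial_sumB !LP//; congr (_ + _).
  by rewrite -[in LHS](subrr (0 : X)) partial_sumB subrr.
(* From [K j] on, the partial sums of [t j] are constant, so the maximum over [n <= K j] dominates
   them all. *)
pose b j := vmaxs (partial_sum^~ (t j)) (K j).+1 + vabs (t j).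
have b0 j : 0 <=v b j by rewrite vadd_ge0 ?vmaxs_ge0 ?vabs_ge0.
have bnorm j : `|b j| <= M + r.
  by apply: le_trans (ler_normD _ _) _; rewrite norm_vabs lerD ?Mr// ltW.
have tb n j : vabs (partial_sum n (t j) - t j) <=v b j.
  apply: vle_tr (vabs_triangle _ _) _; rewrite vabsN vleD ?vle_refl//.
  have [nK|/ltnW Kn] := leqP n (K j); first exact: (vle_vmaxs (partial_sum^~ (t j))).
  by have := vle_vmaxs (partial_sum^~ (t j)) (ltnSn (K j)); rewrite !tfix.
(* The weights [2^-j] make the sum of the [b j] converge, and the factor [4^-j] in [y (j+1) - y j]
   leaves another [2^-j] to spare. *)
pose w j := 2^-1 ^+ j *: b j.
have w0 j : 0 <=v w j by rewrite vscale_ge0 ?exprn_ge0 ?invr_ge0.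
have wcvg : cvgn (series w).
  apply: normed_cvg; apply: (@series_le_cvg _ _ (geometric (M + r) 2^-1)) => //=.
  - by move=> n; rewrite mulr_ge0 ?exprn_ge0 ?invr_ge0// (le_trans _ (bnorm 0%N)).
  - move=> n; rewrite normrZ ger0_norm ?exprn_ge0 ?invr_ge0// mulrC.
    by rewrite ler_wpM2r ?exprn_ge0 ?invr_ge0.
  - by apply: is_cvg_geometric_series; rewrite ger0_norm ?invr_ge0// invf_lt1// ltr1n.
pose z := limn (series w).
have wz J : series w J <=v z.
  apply: (@vle_cvg _ _ (fun=> series w J) (series w)) => //; first exact: cvg_cst.
  near=> n; have Jn : (J <= n)%N by near: n; exact: nbhs_infty_ge.
  by rewrite /series /= (big_cat_nat (leq0n J) Jn)//= vle_addr// vsum_ge0.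
have z0 : 0 <=v z by have := wz 0%N; rewrite /series /= big_geq.
(* The induction starts at [J = i], where [partial_sum n] fixes [y i]; each later difference adds
   one term of the series. *)
have key i n J : (L i <= n)%N -> (i <= J)%N ->
    vabs (partial_sum n (y J) - y J) <=v 2^-1 ^+ i *: series w J.
  move=> Ln; elim: J => [|J ih].
    by rewrite leqn0 => /eqP i0; rewrite -i0 LP// subrr ger0_vabs ?vle_refl//;
      rewrite vscale_ge0 ?exprn_ge0 ?invr_ge0// vsum_ge0.
  rewrite leq_eqVlt => /orP[/eqP iJ|/ltnSE iJ].
    by rewrite -iJ LP// subrr ger0_vabs ?vle_refl//;
      rewrite vscale_ge0 ?exprn_ge0 ?invr_ge0// vsum_ge0.
  have -> : y J.+1 = 4^-1 ^+ J *: t J + y J.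
    by rewrite scalerA -exprMn mulVf// expr1n scale1r subrK.
  rewrite partial_sumZD opprD addrACA -scalerBr addrC.
  apply: vle_tr (vabs_triangle _ _) _.
  rewrite /series /= big_nat_recr//= [X in _ <=v X]scalerDr vleD ?ih//.
  apply: vle_tr (vabsZ_le _ _) _; first by rewrite exprn_ge0 ?invr_ge0.
  apply: (vle_tr (y := 4^-1 ^+ J *: b J)); first by rewrite vleZ ?exprn_ge0 ?invr_ge0.
  rewrite scalerA vleZr// (_ : 4^-1 = 2^-1 * 2^-1 :> R); last by rewrite -invfM -natrM.
  rewrite exprMn ler_wpM2r ?exprn_ge0 ?invr_ge0//.
  by rewrite ler_wiXn2l ?invr_ge0// invf_le1// ler1n.
have lim_key i n : (L i <= n)%N -> vabs (partial_sum n x - x) <=v 2^-1 ^+ i *: z.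
  move=> Ln; apply: (@vle_cvg _ _ (fun J => vabs (partial_sum n (y J) - y J))
     (fun=> 2^-1 ^+ i *: z)); last 1 first.
  - near=> J; apply: vle_tr (key _ _ _ Ln _) _; first by near: J; exact: nbhs_infty_ge.
    by rewrite vleZ ?exprn_ge0 ?invr_ge0.
  - apply: continuous_cvg; first exact: vabs_continuous.
    apply: (cvgB _ ycvg); apply: (continuous_cvg _ _ ycvg); exact: partial_sum_continuous.
  - exact: cvg_cst.
(* The inequality [2^-m <= 1/m] converts the geometric rate into the required one. *)
exists z => // m m0; exists (L m) => // n /= Lmn; apply: vle_tr (lim_key _ _ Lmn) _.
rewrite vleZr// exprVn lef_pV2 ?posrE ?exprn_gt0 ?ltr0n// -natrX ler_nat.
exact/ltnW/ltn_expl.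
Unshelve. all: by end_near. Qed.

End OrderBounded.

(** * Implications between the four kinds of basis *)

Theorem theorem1p2 (AD : analytic_determinacy)
    (R : realType) (X : banachLatticeType R)
    (e : nat -> X) (es : nat -> {scalar X})
    (e_total : closed_span e = [set: X])
    (e_biorth : forall k n : nat, es k (e n) = (k == n)%:R) :
  let P1 := is_basis_with order_cvg e (fun k => es k) in
  let P2 := is_basis_with sigma_order_cvg e (fun k => es k) in
  let P3 := is_basis_with uniform_cvg e (fun k => es k) in
  let P4 := is_basis_with norm_cvg e (fun k => es k) in
  [/\ P1 <-> P2, P2 -> P3, P3 -> P4 &
      (P1 \/ P2 \/ P3 \/ P4) -> forall k : nat, continuous (es k)].
Proof.
move=> P1 P2 P3 P4.
have order_sigma := order_cvgP (rational_span_dense e_total).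
have P12 : P1 <-> P2.
  rewrite /P1 /P2; suff -> : @order_cvg R X = @sigma_order_cvg R X by [].
  by apply/funext => u; apply/funext => x; apply/propext.
have cont2 : P2 -> forall k, continuous (es k).
  by move=> h k; exact: (coordinate_continuous e_total AD parametrized_sigma_order h).
have cont3 : P3 -> forall k, continuous (es k).
  by move=> h k; exact: (coordinate_continuous e_total AD parametrized_uniform h).
have cont4 : P4 -> forall k, continuous (es k).
  by move=> h k; exact: (coordinate_continuous e_total AD parametrized_norm h).
have expansion (C : (nat -> X) -> X -> Prop) x : is_basis_with C e (fun k => es k) ->
    C (partial_sum e es ^~ x) x.
  move=> [basis coord]; have [a [ax _]] := basis x.
  have aE : a = es^~ x by apply/funext => k; rewrite (coord _ _ ax).
  by rewrite aE in ax.
have basisI (C : (nat -> X) -> X -> Prop) : (forall x, C (partial_sum e es ^~ x) x) ->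
    (forall x a, sums_to C e a x -> forall k, es k x = a k) -> is_basis_with C e (fun k => es k).
  move=> Cx Ca; split=> // x; exists (es^~ x); split; first exact: Cx.
  by move=> a /Ca h; apply/funext => k.
split => //.
(* A uniform expansion is also a sigma-order expansion, so its coefficients are already determined;
   existence rests on order boundedness. *)
- move=> p2; apply: basisI => [x|x a /uniform_sigma_order_cvg]; last exact: p2.2.
  apply: order_bounded_uniform_cvg => //; first exact: cont2.
  move=> {}x; have [z [_ _ /(_ 0%N)[N _ NP]]] := expansion _ x p2.
  (* The first term bounds the partial sums before [N], the second those from [N] on. *)
  exists (vmaxs (partial_sum e es ^~ x) N + (z 0%N + vabs x)) => n.
  have [nN|Nn] := ltnP n N.
    apply: (vle_tr (vle_vmaxs (partial_sum e es ^~ x) nN)).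
    rewrite vle_addr// vadd_ge0 ?vabs_ge0//.
    exact: vle_tr (vabs_ge0 _) (NP N (leqnn _)).
  apply: (vle_tr (y := z 0%N + vabs x)); last by rewrite vle_addl// vmaxs_ge0.
  rewrite -[partial_sum e es n x](subrK x).
  apply: vle_tr (vabs_triangle _ _) _; rewrite vleD ?vle_refl//; exact: NP.
- move=> p3; apply: basisI => [x|x a ax k]; first exact: (uniform_norm_cvg (expansion _ x p3)).
  (* For uniqueness, the values of the continuous [es k] on the partial sums tend to [es k x] and,
     by biorthogonality, equal [a k] from index [k + 1] on. *)
  pose S := series (fun n => a n *: e n).
  have Sx : es k (S n) @[n --> \oo] --> es k x.
    by apply: (continuous_cvg _ _ ax); exact: cont3.
  have Sa : es k (S n) @[n --> \oo] --> a k.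
    apply: cvg_near_cst; exists k.+1 => // n /= kn.
    rewrite /S /series /= raddf_sum (bigD1_seq k) ?iota_uniq ?mem_index_iota//=.
    rewrite linearZ /= e_biorth eqxx mulr1 big1 ?addr0// => i ik.
    by rewrite linearZ /= e_biorth eq_sym (negbTE ik) mulr0.
  exact: (cvg_unique _ Sx Sa).
by move=> [/P12|[|[]]].
Qed.
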